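(* Let $N\ge1$, generic complex $q,\gamma,s_0,\xi_0$, and $u_i,v_j$ with $|u_iv_j|<1$ for all $i,j$. Then $$\frac{\det[\mathsf z(u_i,v_j)]_{i,j=1}^N}{\prod_{1\le i<j\le N}(u_i-u_j)(v_i-v_j)}=\sum_{\lambda\in\mathrm{Sign}_N}\mathsf C_\lambda(u_1,\dots,u_N)\,s_\lambda(v_1,\dots,v_N),$$ where $\mathsf C_\lambda$ is the symmetric polynomial $$\mathsf C_\lambda(u_1,\dots,u_N)=\frac{\det[\mathsf c_{\lambda_i+N-i}(u_j)]_{i,j=1}^N}{\prod_{1\le i<j\le N}(u_i-u_j)},$$ $$\mathsf c_k(u)=u^k\Big\{1-\gamma q^{k+1}+s_0^2\gamma(\gamma-q^k)-s_0\gamma\big((1-q^k)(u\xi_0)^{-1}+(1-q^{k+1})u\xi_0\big)\Big\},$$ and equivalently $$\mathsf C_\lambda=\det\Big[-\gamma s_0\xi_0^{-1}(1-q^{\lambda_j+N-j})h_{\lambda_j+i-j-1}+\big(1+\gamma^2s_0^2-\gamma(q+s_0^2)q^{\lambda_j+N-j}\big)h_{\lambda_j+i-j}-\gamma s_0\xi_0(1-q^{\lambda_j+N-j+1})h_{\lambda_j+i-j+1}\Big]_{i,j=1}^N,$$ with $h_k=h_k(u_1,\dots,u_N)$. In particular, when $s_0=0$, $\mathsf C_\lambda=\prod_{j=1}^N(1-\gamma q\cdot q^{\lambda_j+N-j})\,s_\lambda(u_1,\dots,u_N)$.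
   Context: $\mathrm{Sign}_N$ is the set of integer sequences $\lambda=(\lambda_1\ge\dots\ge\lambda_N\ge0)$. $\mathsf z(u,v)=\frac{(1-\gamma)(q-\gamma s_0^2)(1-uv)+(1-q)(1-\gamma\xi_0s_0u)(1-\gamma\xi_0^{-1}s_0v)}{(1-uv)(1-quv)}$. $s_\lambda(v_1,\dots,v_N)=\det[v_i^{\lambda_j+N-j}]/\prod_{i<j}(v_i-v_j)$ is the Schur polynomial, and $h_k$ is the complete homogeneous symmetric polynomial of degree $k$, with $h_0=1$ and $h_k=0$ for $k<0$.
   Formalization: The formal theorem also assumes |q u_i v_j|<1 for all i,j, without which the series over Sign_N diverges for generic q; ''generic'' is made explicit as ξ_0≠0, u_i≠0, and the u_i, and likewise the v_j, pairwise distinct. *)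

(* Defs.v *)
From HB Require Import structures.
From mathcomp Require Import all_boot all_order all_algebra.
From mathcomp Require Import reals.
From mathcomp.real_closed Require Import complex.
Set Implicit Arguments. Unset Strict Implicit. Unset Printing Implicit Defensive.
Import Order.TTheory GRing.Theory Num.Theory.
Local Open Scope ring_scope.
Local Open Scope complex_scope.

Section Defs.
Variable R : realType.
Local Notation C := R[i].

Definition zfun (q g s0 xi0 u v : C) : C :=
  ((1 - g) * (q - g * s0 ^+ 2) * (1 - u * v)
   + (1 - q) * (1 - g * xi0 * s0 * u) * (1 - g * xi0^-1 * s0 * v))
  / ((1 - u * v) * (1 - q * u * v)).

Definition cfun (q g s0 xi0 : C) (k : nat) (u : C) : C :=
  u ^+ k * (1 - g * q ^+ k.+1 + s0 ^+ 2 * g * (g - q ^+ k)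
            - s0 * g * ((1 - q ^+ k) * (u * xi0)^-1 + (1 - q ^+ k.+1) * u * xi0)).

Definition vdm (N : nat) (x : 'I_N -> C) : C :=
  \prod_(i < N) \prod_(j < N | (i < j)%N) (x i - x j).

(* lambda_i + N - i in 1-based indexing = lambda_i + N - (i+1) 0-based *)
Definition shifted (N : nat) (lam : 'I_N -> nat) (i : 'I_N) : nat :=
  (lam i + N - i.+1)%N.

Definition schur (N : nat) (lam : 'I_N -> nat) (x : 'I_N -> C) : C :=
  \det (\matrix_(i < N, j < N) x i ^+ shifted lam j) / vdm x.

Definition hcomp (N : nat) (k : int) (x : 'I_N -> C) : C :=
  match k with
  | Posz n => \sum_(m : {ffun 'I_N -> 'I_n.+1} | (\sum_i (m i : nat))%N == n)
                 \prod_i x i ^+ m i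
  | Negz _ => 0
  end.

Definition Clam (q g s0 xi0 : C) (N : nat) (lam : 'I_N -> nat) (u : 'I_N -> C) : C :=
  \det (\matrix_(i < N, j < N) cfun q g s0 xi0 (shifted lam i) (u j)) / vdm u.

Definition is_sign (N : nat) (lam : 'I_N -> nat) : Prop :=
  forall i j : 'I_N, (i <= j)%N -> (lam j <= lam i)%N.

(* a signature with lambda_1 < M, encoded as a finite function *)
Definition signb (N M : nat) (lam : {ffun 'I_N -> 'I_M}) : bool :=
  [forall i : 'I_N, forall j : 'I_N, (i <= j)%N ==> (lam j <= lam i)%N].

Definition lamnat (N M : nat) (lam : {ffun 'I_N -> 'I_M}) : 'I_N -> nat :=
  fun i => nat_of_ord (lam i).

Definition partial_sum (N M : nat) (F : ('I_N -> nat) -> C) : C :=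
  \sum_(lam : {ffun 'I_N -> 'I_M} | signb lam) F (lamnat lam).

End Defs.

(* Main.v *)
Require Import Defs.
From HB Require Import structures.
From mathcomp Require Import all_boot all_order all_algebra all_fingroup.
From mathcomp Require Import reals boolp classical_sets topology normedtype sequences.
From mathcomp.real_closed Require Import complex.
From mathcomp Require Import zify ring.
Set Implicit Arguments. Unset Strict Implicit. Unset Printing Implicit Defensive.
Import Order.TTheory GRing.Theory Num.Theory numFieldNormedType.Exports.
Local Open Scope ring_scope.
Local Open Scope complex_scope.

(** For [u <> 0], [c_k(u) v^k = alpha(u) (u v)^k + beta(u) (q u v)^k], so [z(u,v)]
    is the sum of the convergent series [sum_k c_k(u) v^k], by partial fractions.
    Truncating that series at [k < M + N - 1], the Cauchy-Binet formula gives
    exactly the partial sum over the signatures with [lambda_1 < M], because the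
    strictly decreasing sequences [lambda_i + N - i] are the column sets of the
    truncated matrix. Convergence is then continuity of the determinant, and
    summability follows by expanding both minors into products of geometric series.

    The formula in the [h_k] comes from [1/(1 - u_j t) = prod_(k <> j) (1 - u_k t) H(t)],
    which writes every power of [u_j] as a combination of complete homogeneous
    polynomials with coefficients in a matrix whose determinant is the Vandermonde
    product. *)

(** * Cauchy-Binet formula and signatures *)

Definition strict_decr (N n : nat) (f : {ffun 'I_N -> 'I_n}) : bool :=
  [forall i : 'I_N, forall j : 'I_N, (i < j)%N ==> (f j < f i)%N].

Lemma strict_decrP (N n : nat) (f : {ffun 'I_N -> 'I_n}) :
  reflect (forall i j : 'I_N, (i < j)%N -> (f j < f i)%N) (strict_decr f).
Proof.
apply: (iffP forallP) => [H i j|H i].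
  by move/forallP: (H i) => /(_ j)/implyP; apply.
by apply/forallP => j; apply/implyP; apply: H.
Qed.

(** Together with [strict_decr], this parametrises the injective maps: a column set, listed
    decreasingly, and an ordering of it. Cauchy-Binet groups its terms along this bijection. *)
Definition ffun_perm (N n : nat) (fs : {ffun 'I_N -> 'I_n} * 'S_N) :
  {ffun 'I_N -> 'I_n} := [ffun i => fs.1 (fs.2 i)].

Lemma strict_decr_inj (N n : nat) (f : {ffun 'I_N -> 'I_n}) :
  strict_decr f -> injective f.
Proof.
move/strict_decrP=> H i j eqf; apply: val_inj => /=.
by case: (ltngtP i j) => // /H; rewrite eqf ltnn.
Qed.

Lemma strict_decr_sorted (N n : nat) (f : {ffun 'I_N -> 'I_n}) :
  strict_decr f -> sorted (fun a b : 'I_n => (b <= a)%N) [tuple f i | i < N].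
Proof.
move/strict_decrP=> H /=.
apply: (@homo_sorted _ _ f (fun a b : 'I_N => (a < b)%N)).
  by move=> i j /H /ltnW.
by have := iota_ltn_sorted 0 N; rewrite -val_enum_ord sorted_map.
Qed.

(** The decreasing rearrangement of the values of [ffun_perm (f, s)] is [f], so the image determines
    [f]; injectivity of [f] then recovers [s]. *)
Lemma ffun_perm_inj (N n : nat) :
  {in [set fs : {ffun 'I_N -> 'I_n} * 'S_N | strict_decr fs.1] &,
   injective (@ffun_perm N n)}.
Proof.
move=> [f s] [f' s']; rewrite !inE /= => df df' /ffunP eqh.
have perm_tuple (g : {ffun 'I_N -> 'I_n}) (t : 'S_N) :
    perm_eq [tuple ffun_perm (g, t) i | i < N] [tuple g i | i < N].
  apply/tuple_permP; exists t; congr (tval _); apply: eq_from_tnth => i.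
  by rewrite !tnth_mktuple ffunE.
have eqf : f = f'.
  have eqc : [tuple f i | i < N] = [tuple f' i | i < N].
    apply: val_inj; apply: (@sorted_eq _ (fun a b : 'I_n => (b <= a)%N)).
    - by move=> x y z /=; lia.
    - by move=> x y /= /anti_leq /val_inj.
    - exact: strict_decr_sorted.
    - exact: strict_decr_sorted.
    rewrite -(permPr (perm_tuple f' s')) perm_sym -(permPr (perm_tuple f s)).
    by move/ffunP: eqh => ->.
  by apply/ffunP => i; rewrite -[LHS](tnth_mktuple f) eqc tnth_mktuple.
subst f'; congr (_, _); apply/permP => i.
by have := eqh i; rewrite !ffunE /= => /(strict_decr_inj df).
Qed.

(** Sorting the values of an injective [g] gives a weakly decreasing list. It has no repetition, so
    it is strictly decreasing, and the sorting permutation is the second component. *)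
Lemma ffun_perm_image (N n : nat) :
  [set g : {ffun 'I_N -> 'I_n} | injectiveb g] =
  @ffun_perm N n @: [set fs | strict_decr fs.1].
Proof.
apply/setP => g; rewrite inE; apply/idP/imsetP => [/injectiveP inj_g|]; last first.
  case=> -[f s]; rewrite inE /= => /strict_decr_inj inj_f ->.
  by apply/injectiveP => i j; rewrite !ffunE /= => /inj_f /perm_inj.
pose ge (a b : 'I_n) := (b <= a)%N.
pose c := [tuple g i | i < N].
have sz : size (sort ge c) == N by rewrite size_sort size_tuple.
pose t := Tuple sz.
have : perm_eq c t by rewrite perm_sym perm_sort.
case/tuple_permP => s /val_inj eqs.
exists ([ffun i => tnth t i], s); last first.
  apply/ffunP => i; rewrite !ffunE /=.
  by rewrite -[LHS](tnth_mktuple g) -/c eqs tnth_mktuple.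
rewrite inE; apply/strict_decrP => i j ltij; rewrite !ffunE /=.
have srt : sorted ge t by apply: sort_sorted => x y; rewrite /ge; lia.
have ut : uniq t by rewrite sort_uniq map_inj_uniq ?enum_uniq.
have: ge (tnth t i) (tnth t j).
  rewrite !(tnth_nth (g i)); apply: sorted_leq_nth => //.
  - by move=> x y z; rewrite /ge; lia.
  - by move=> x; rewrite /ge.
  - by rewrite inE size_tuple.
  - by rewrite inE size_tuple.
  exact: ltnW.
rewrite /ge leq_eqVlt => /orP[/eqP/val_inj e|//].
by move/tuple_uniqP: ut => /(_ _ _ e) eij; rewrite eij ltnn in ltij.
Qed.

(** Expanding the rows of [A *m B] gives a sum over all maps [f]. Maps with a repeated value repeat
    a row of [B] and contribute zero; the injective ones are grouped by their decreasing
    rearrangement, and the sum over orderings rebuilds the minor of [A]. *)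
Theorem Cauchy_Binet (R : comNzRingType) (N n : nat)
    (A : 'M[R]_(N, n)) (B : 'M[R]_(n, N)) :
  \det (A *m B) = \sum_(f : {ffun 'I_N -> 'I_n} | strict_decr f)
                     \det (colsub f A) * \det (rowsub f B).
Proof.
pose T (f : {ffun 'I_N -> 'I_n}) := (\prod_i A i (f i)) * \det (rowsub f B).
have -> : \det (A *m B) = \sum_(f : {ffun _ -> _} | injectiveb f) T f.
  transitivity (\sum_f T f).
    rewrite /determinant.
    under eq_bigr => s _.
      under eq_bigr => i _ do rewrite mxE.
      rewrite bigA_distr_bigA big_distrr /=; over.
    rewrite exchange_big /=; apply: eq_bigr => f _.
    rewrite /T big_distrr /=; apply: eq_bigr => s _.
    rewrite big_split /= mulrCA; congr (_ * (_ * _)).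
    by apply: eq_bigr => i _; rewrite mxE.
  rewrite (bigID (fun f : {ffun 'I_N -> 'I_n} => injectiveb f)) /= addrC big1 ?add0r //.
  move=> f /injectivePn[i [j neq_ij eqf]]; rewrite /T.
  rewrite (determinant_alternate neq_ij) ?mulr0 // => k.
  by rewrite !mxE eqf.
transitivity (\sum_(f in [set g : {ffun 'I_N -> 'I_n} | injectiveb g]) T f).
  by apply: eq_bigl => f; rewrite inE.
rewrite ffun_perm_image big_imset /=; last exact: ffun_perm_inj.
under eq_bigl do rewrite inE -[strict_decr _]andbT.
rewrite -(pair_big (fun f : {ffun 'I_N -> 'I_n} => strict_decr f) predT
           (fun f s => T (ffun_perm (f, s)))) /=.
apply: eq_bigr => f _; rewrite {1}/determinant big_distrl /=.
apply: eq_bigr => s _; rewrite /T mulrAC mulrC; congr (_ * _); last first.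
  by apply: eq_bigr => i _; rewrite ffunE mxE.
(* The sign of [s] is the determinant of a permutation matrix, which reorders the rows of
   [rowsub f B]. *)
rewrite -det_perm -det_mulmx; congr (\det _).
by rewrite -row_permE; apply/matrixP => i j; rewrite !mxE ffunE.
Qed.

(** * Signatures as strictly decreasing sequences *)

Lemma is_signP (N M : nat) (lam : {ffun 'I_N -> 'I_M}) :
  reflect (is_sign (lamnat lam)) (signb lam).
Proof.
apply: (iffP forallP) => [H i j|H i].
  by move/forallP: (H i) => /(_ j)/implyP; apply.
by apply/forallP => j; apply/implyP; apply: H.
Qed.

Lemma shifted_lt (N M : nat) (lam : {ffun 'I_N.+1 -> 'I_M}) (i : 'I_N.+1) :
  (shifted (lamnat lam) i < M + N)%N.
Proof. by rewrite /shifted /lamnat; have := ltn_ord (lam i); lia. Qed.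

Definition shift_ffun (N M : nat) (lam : {ffun 'I_N.+1 -> 'I_M}) :
  {ffun 'I_N.+1 -> 'I_(M + N)} := [ffun i => Ordinal (shifted_lt lam i)].

(** Each step of the index costs at least one unit. Comparison with the first and the last index
    gives the two bounds that follow. *)
Lemma strict_decr_gap (N n : nat) (f : {ffun 'I_N -> 'I_n}) (i j : 'I_N) :
  strict_decr f -> (i <= j)%N -> (f j + (j - i) <= f i)%N.
Proof.
move=> /strict_decrP df; move: {2}(j - i)%N (erefl (j - i)%N) => d.
elim: d j => [|d IHd] j def_d le_ij.
  by rewrite (_ : i = j) ?subnn ?addn0 //; apply: val_inj => /=; lia.
have lt_j : (j.-1 < N)%N by have := ltn_ord j; lia.
have /= := IHd (Ordinal lt_j); have /= := df (Ordinal lt_j) j.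
by move=> H1 H2; have := H1 ltac:(lia); have := H2 ltac:(lia) ltac:(lia); lia.
Qed.

Lemma strict_decr_ub (N n : nat) (f : {ffun 'I_N.+1 -> 'I_n}) (i : 'I_N.+1) :
  strict_decr f -> (f i + i < n)%N.
Proof.
move=> df; have := @strict_decr_gap _ _ f ord0 i df isT.
by have := ltn_ord (f ord0); rewrite subn0; lia.
Qed.

Lemma strict_decr_lb (N n : nat) (f : {ffun 'I_N.+1 -> 'I_n}) (i : 'I_N.+1) :
  strict_decr f -> (N - i <= f i)%N.
Proof.
move=> df; have := @strict_decr_gap _ _ f i ord_max df (leq_ord i).
by rewrite /=; lia.
Qed.

Lemma shift_ffun_surj (N M : nat) (f : {ffun 'I_N.+1 -> 'I_(M + N)}) :
  strict_decr f -> exists2 lam : {ffun 'I_N.+1 -> 'I_M}, signb lam & f = shift_ffun lam.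
Proof.
move=> df.
(* The candidate part is [f i - (N - i)]: the lower bound on [f i] makes this natural subtraction
   exact, and the upper bound keeps it below [M]. *)
have ltM (i : 'I_N.+1) : (f i - (N - i) < M)%N.
  have := strict_decr_ub i df; have := strict_decr_lb i df.
  by have := leq_ord i; lia.
exists [ffun i => Ordinal (ltM i)].
  apply/is_signP => i j le_ij; rewrite /lamnat !ffunE /=.
  have := strict_decr_gap df le_ij; have := strict_decr_lb i df.
  by have := strict_decr_lb j df; have := leq_ord j; lia.
apply/ffunP => i; rewrite ffunE; apply: val_inj.
rewrite /= /shifted /lamnat ffunE /=.
by have := strict_decr_lb i df; have := leq_ord i; lia.
Qed.

Lemma shift_ffun_image (N M : nat) :
  [set f : {ffun 'I_N.+1 -> 'I_(M + N)} | strict_decr f] =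
  @shift_ffun N M @: [set lam | signb lam].
Proof.
apply/setP => f; rewrite inE; apply/idP/imsetP => [/shift_ffun_surj[lam]|].
  by exists lam; rewrite ?inE.
case=> lam; rewrite inE => /is_signP slam ->.
apply/strict_decrP => i j lt_ij; rewrite !ffunE /=.
by have := slam i j (ltnW lt_ij); rewrite /shifted; have := leq_ord j; lia.
Qed.

Lemma shift_ffun_inj (N M : nat) : injective (@shift_ffun N M).
Proof.
move=> lam mu /ffunP eqs; apply/ffunP => i; have := congr1 val (eqs i).
rewrite !ffunE /= /shifted /lamnat => e; apply: val_inj.
by have := leq_ord i; rewrite /=; lia.
Qed.

(** Reindexing along [shift_ffun]. Extensionality of [G] is assumed because the finite function
    [shift_ffun lam] is matched with [shifted (lamnat lam)] pointwise. *)
Lemma sum_strict_decr_signb (V : nmodType) (N M : nat)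
    (G : ('I_N.+1 -> nat) -> V) :
  (forall f g, f =1 g -> G f = G g) ->
  \sum_(f : {ffun 'I_N.+1 -> 'I_(M + N)} | strict_decr f)
      G (fun i => f i) =
  \sum_(lam : {ffun 'I_N.+1 -> 'I_M} | signb lam) G (shifted (lamnat lam)).
Proof.
move=> extG.
transitivity (\sum_(f in [set g : {ffun 'I_N.+1 -> 'I_(M + N)} | strict_decr g])
                  G (fun i => f i)).
  by apply: eq_bigl => f; rewrite inE.
rewrite shift_ffun_image big_imset /=; last by move=> ? ? _ _; apply: shift_ffun_inj.
apply: eq_big => [lam|lam _]; first by rewrite inE.
by apply: extG => i; rewrite ffunE.
Qed.

(** * Complete homogeneous polynomials *)

(** Congruence modulo ['X^(n.+1)], so that polynomials can stand for truncated power series. *)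
Definition eq_upto (R : nzRingType) (n : nat) (p q : {poly R}) : Prop :=
  forall i, (i <= n)%N -> p`_i = q`_i.

Lemma eq_uptoM (R : nzRingType) (n : nat) (p p' q q' : {poly R}) :
  eq_upto n p p' -> eq_upto n q q' -> eq_upto n (p * q) (p' * q').
Proof.
move=> eqp eqq i le_in; rewrite !coefM; apply: eq_bigr => j _.
by rewrite eqp ?eqq //; have := leq_ord j; lia.
Qed.

Lemma eq_upto_prod (R : nzRingType) (n : nat) (I : Type) (r : seq I)
    (P : pred I) (p q : I -> {poly R}) :
  (forall k, eq_upto n (p k) (q k)) ->
  eq_upto n (\prod_(k <- r | P k) p k) (\prod_(k <- r | P k) q k).
Proof.
by move=> eqpq; apply: (big_ind2 (eq_upto n)) => // ? ? ? ?; apply: eq_uptoM.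
Qed.

Definition geom_poly (R : nzRingType) (n : nat) (x : R) : {poly R} :=
  \poly_(m < n.+1) x ^+ m.

Lemma geom_polyK (R : comNzRingType) (n : nat) (x : R) :
  eq_upto n ((1 - x *: 'X) * geom_poly n x) 1.
Proof.
move=> i le_in; rewrite mulrBl mul1r -scalerAl coefB coefZ coefXM coef1.
rewrite !coef_poly ltnS le_in; case: i le_in => [|i] le_in /=.
  by rewrite mulr0 subr0.
by rewrite ltnS (ltnW le_in) -exprS subrr.
Qed.

Section CompleteHomogeneous.
Variables (R : realType) (N : nat) (u : 'I_N -> R[i]).
Implicit Types (a n : nat) (i j : 'I_N).

(** Distributing the product of truncated geometric series over the choices of one exponent per
    variable gives exactly the sum that defines [hcomp]: exponents up to [n] suffice in degree
    [n]. *)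
Lemma hcompE n : hcomp n u = (\prod_k geom_poly n (u k))`_n.
Proof.
under eq_bigr do rewrite /geom_poly poly_def.
rewrite bigA_distr_bigA coef_sum /= big_mkcond; apply: eq_bigr => f _.
rewrite (_ : \prod_i _ = (\prod_i u i ^+ f i) *: 'X^(\sum_i f i)); last first.
  by rewrite scaler_prod -(big_morph (fun m => 'X^m) (exprD _) (expr0 _)).
by rewrite coefZ coefXn eq_sym; case: eqP => _; rewrite ?mulr1 ?mulr0.
Qed.

Lemma coef_prod_geom_poly n a : (a <= n)%N ->
  (\prod_k geom_poly n (u k))`_a = hcomp a u.
Proof.
move=> le_an; rewrite hcompE; apply: (@eq_upto_prod _ a) => // k i le_ia.
by rewrite !coef_poly !ltnS le_ia (leq_trans le_ia).
Qed.

Lemma hcomp0 : hcomp 0 u = 1.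
Proof.
rewrite -[0%R]/(Posz 0) hcompE big1 ?coef1 // => k _.
by rewrite /geom_poly poly_def big_ord1 expr0 scale1r.
Qed.

(* The numbers (-1)^m e_m of the variables other than u_j, in reverse order. *)
Definition codual j l : R[i] :=
  (\prod_(k | k != j) (1 - u k *: 'X))`_(N - l.+1).

Lemma size_codual j : (size (\prod_(k | k != j) (1 - u k *: 'X))%R <= N)%N.
Proof.
have sz1 (k : 'I_N) : (size (1 - u k *: 'X)%R <= 2)%N.
  apply: (leq_trans (size_polyD _ _)); rewrite size_poly1 size_polyN geq_max /=.
  by rewrite (leq_trans (size_scale_leq _ _)) ?size_polyX.
apply: (leq_trans (size_poly_prod_leq _ _)).
rewrite cardC1 card_ord.
have : (\sum_(k | k != j) size (1 - u k *: 'X)%R <= \sum_(k | k != j) 2)%N.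
  by apply: leq_sum.
rewrite sum_nat_const cardC1 card_ord; have := ltn_ord j; lia.
Qed.

(* Compare coefficients in 1/(1 - u_j t) = prod_(k <> j) (1 - u_k t) * H(t). *)
Lemma expr_hcomp a j :
  u j ^+ a = \sum_(l < N) hcomp (a%:Z - (N - l.+1)%:Z) u * codual j l.
Proof.
have eqg : eq_upto a (\prod_(k | k != j) (1 - u k *: 'X) *
                      \prod_k geom_poly a (u k)) (geom_poly a (u j)).
  rewrite [X in _ * X](bigD1 j) //= mulrCA -big_split /=.
  rewrite -[X in eq_upto _ _ X]mulr1; apply: eq_uptoM => //.
  have e1 : (1 : {poly R[i]}) = \prod_(k | k != j) 1 by rewrite big1.
  rewrite [X in eq_upto _ _ X]e1.
  by apply: eq_upto_prod => k; apply: geom_polyK.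
have := eqg a (leqnn a); rewrite [RHS]coef_poly leqnn => <-.
pose G (m : nat) := hcomp (a%:Z - m%:Z) u * (\prod_(k | k != j) (1 - u k *: 'X))`_m.
rewrite coefM (eq_bigr (fun m : 'I_a.+1 => G m)); last first.
  move=> m _; rewrite mulrC coef_prod_geom_poly ?leq_subr // /G.
  by rewrite subzn // leq_ord.
rewrite [RHS](reindex_inj rev_ord_inj) /=.
rewrite [RHS](eq_bigr (fun m : 'I_N => G m)); last first.
  move=> m _; rewrite /codual /= (_ : (N - (N - m.+1).+1)%N = m) //.
  by have := ltn_ord m; lia.
(* The two sums have lengths [N] and [a.+1]. Both extend by zeros to a common length: past [N] the
   polynomial coefficient vanishes by degree, past [a] the index of [hcomp] is negative. *)
have widen b : (b <= N + a.+1)%N ->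
    (forall m, (b <= m)%N -> G m = 0) ->
    \sum_(m < b) G m = \sum_(m < N + a.+1) G m.
  move=> le_b G0; rewrite (big_ord_widen _ G le_b) big_mkcond.
  by apply: eq_bigr => m _; case: ltnP => // /G0.
rewrite !widen ?leq_addl ?leq_addr // => m le_m.
  by rewrite /G nth_default ?mulr0 // (leq_trans (size_codual j)).
by rewrite /G (_ : a%:Z - m%:Z = Negz (m - a.+1)) ?mul0r //; lia.
Qed.

Lemma det_vdm : \det (\matrix_(i < N, j < N) u j ^+ (N - i.+1)) = vdm u.
Proof.
(* Decreasing exponents and factors [u i - u j] are the reverse of the library convention. Reversing
   rows and columns uses the same permutation twice, so the signs cancel. *)
pose y := \row_j u (rev_ord j).
pose s := perm (@rev_ord_inj N).
have -> : \matrix_(i < N, j < N) u j ^+ (N - i.+1) =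
    row_perm s (col_perm s (Vandermonde N y)).
  apply/matrixP => i j; by rewrite !mxE !permE rev_ordK.
rewrite row_permE col_permE !det_mulmx !det_perm det_Vandermonde odd_permV.
rewrite mulrCA -expr2 sqrr_sign mulr1 /vdm [RHS](reindex_inj rev_ord_inj) /=.
under [RHS]eq_bigr do rewrite (reindex_inj rev_ord_inj) /=.
rewrite [RHS](exchange_big_dep predT) //=.
apply: eq_bigr => i _; apply: eq_big => j; last by rewrite !mxE.
by have := ltn_ord i; have := ltn_ord j; lia.
Qed.

(** Expanding the powers [u j ^+ (N - i.+1)] by [expr_hcomp] factors the Vandermonde matrix through
    [H], which is unitriangular since [h_0] is 1 and [h_k] vanishes for negative [k]. *)
Lemma det_codual : \det (\matrix_(l < N, j < N) codual j l) = vdm u.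
Proof.
rewrite -det_vdm.
pose H := \matrix_(l < N, i < N) hcomp (l%:Z - i%:Z) u.
have detH : \det H = 1.
  rewrite det_trig ?big1 // => [i _|]; first by rewrite mxE subrr hcomp0.
  apply/is_trig_mxP => l i lt_li; rewrite mxE.
  by rewrite (_ : l%:Z - i%:Z = Negz (i - l.+1)) //; lia.
rewrite -[LHS]mul1r -detH -(det_tr H) -det_mulmx; congr (\det _).
apply/matrixP => i j; rewrite !mxE expr_hcomp; apply: eq_bigr => l _.
rewrite !mxE; congr (hcomp _ _ * _).
by have := ltn_ord i; have := ltn_ord l; lia.
Qed.

Lemma det_codual_expansion (a : 'I_N -> 'I_N -> R[i]) (M : 'M[R[i]]_N) :
  (forall i j, a i j = \sum_l M l i * codual j l) ->
  \det (\matrix_(i < N, j < N) a i j) = \det M * vdm u.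
Proof.
move=> aE; rewrite -det_codual -(det_tr M) -det_mulmx; congr (\det _).
by apply/matrixP => i j; rewrite !mxE aE; apply: eq_bigr => l _; rewrite !mxE.
Qed.

End CompleteHomogeneous.

Lemma vdm_neq0 (R : realType) (N : nat) (x : 'I_N -> R[i]) :
  (forall i j, i != j -> x i != x j) -> vdm x != 0.
Proof.
move=> inj_x; apply/prodf_neq0 => i _; apply/prodf_neq0 => j lt_ij.
by rewrite subr_eq0; apply: inj_x; apply: contraTneq lt_ij => ->; rewrite ltnn.
Qed.

(** [cfun] combines the powers [k - 1], [k] and [k + 1] of [u j], and [expr_hcomp] expands all three
    over the same [codual u j l]. *)
Lemma cfun_hcomp (R : realType) (q g s0 xi0 : R[i]) (N : nat)
    (u : 'I_N -> R[i]) (lam : 'I_N -> nat) (i j : 'I_N) :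
  u j != 0 ->
  cfun q g s0 xi0 (shifted lam i) (u j) =
  \sum_(l < N)
   (- g * s0 * xi0^-1 * (1 - q ^+ shifted lam i)
        * hcomp ((lam i)%:Z + l%:Z - i%:Z - 1) u
    + (1 + g ^+ 2 * s0 ^+ 2 - g * (q + s0 ^+ 2) * q ^+ shifted lam i)
        * hcomp ((lam i)%:Z + l%:Z - i%:Z) u
    - g * s0 * xi0 * (1 - q ^+ (shifted lam i).+1)
        * hcomp ((lam i)%:Z + l%:Z - i%:Z + 1) u) * codual u j l.
Proof.
move=> uj0; set k := shifted lam i; have kE : k = shifted lam i by [].
clearbody k.
pose S (e : int) := \sum_(l < N) hcomp ((lam i)%:Z + l%:Z - i%:Z + e) u * codual u j l.
have Sadd (a : nat) (e : int) : a%:Z = k%:Z + e -> u j ^+ a = S e.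
  move=> aE; rewrite expr_hcomp; apply: eq_bigr => l _; congr (hcomp _ _ * _).
  by rewrite aE kE /shifted; have := ltn_ord i; have := ltn_ord l; lia.
have S0 : u j ^+ k = S 0 by apply: Sadd; rewrite addr0.
have S1 : u j ^+ k.+1 = S 1 by apply: Sadd; lia.
(* For [k = 0] the power [k - 1] is not a natural one, but its coefficient [1 - q ^+ 0] is zero. *)
have Sm : (1 - q ^+ k) * (u j ^+ k * (u j * xi0)^-1) =
          (1 - q ^+ k) * (xi0^-1 * S (-1)).
  case def_k: k => [|k']; first by rewrite expr0 subrr !mul0r.
  rewrite -(@Sadd k'); last lia.
  by rewrite (exprSr (u j)) invfM -mulrA mulVKf // [xi0^-1 * _]mulrC.
transitivity (- g * s0 * xi0^-1 * (1 - q ^+ k) * S (-1)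
   + (1 + g ^+ 2 * s0 ^+ 2 - g * (q + s0 ^+ 2) * q ^+ k) * S 0
   - g * s0 * xi0 * (1 - q ^+ k.+1) * S 1).
  rewrite -S1 -S0 /cfun.
  transitivity (- g * s0 * ((1 - q ^+ k) * (u j ^+ k * (u j * xi0)^-1))
   + (1 + g ^+ 2 * s0 ^+ 2 - g * (q + s0 ^+ 2) * q ^+ k) * u j ^+ k
   - g * s0 * xi0 * (1 - q ^+ k.+1) * u j ^+ k.+1).
    by set w := (u j * xi0)^-1; rewrite !exprS; ring.
  by rewrite Sm; ring.
rewrite /S !mulr_sumr -sumrN -!big_split /=; apply: eq_bigr => l _.
by rewrite addr0; ring.
Qed.

(** * Limits and bounds *)

(** Over [R[i]], [0 < eps] forces [eps] to be real, so this is ordinary convergence. *)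
Definition eps_cvg (K : numFieldType) (a : nat -> K) (l : K) : Prop :=
  forall eps : K, 0 < eps -> exists M0, forall M, (M0 <= M)%N -> `|a M - l| < eps.

Lemma eps_cvgP (K : numFieldType) (a : nat -> K) (l : K) :
  eps_cvg a l <-> (a m @[m --> \oo] --> l)%classic.
Proof.
split=> [cva|/cvgrPdist_lt cva eps eps_gt0].
  apply/cvgrPdist_lt => eps /cva[M0 lt_eps]; exists M0 => // m le_m.
  by rewrite /= distrC; apply: lt_eps.
have [M0 _ lt_eps] := cva eps eps_gt0.
by exists M0 => M le_M; rewrite distrC; apply: lt_eps.
Qed.

Lemma eps_cvg_det (K : numFieldType) (n : nat) (A : nat -> 'M[K]_n) (L : 'M[K]_n) :
  (forall i j, eps_cvg (fun m => A m i j) (L i j)) ->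
  eps_cvg (fun m => \det (A m)) (\det L).
Proof.
move=> cvA; apply/eps_cvgP; rewrite /determinant.
apply: cvg_big => [|s _]; first exact: add_continuous.
apply: cvgM; first exact: cvg_cst.
apply: cvg_big => [|i _]; first exact: mul_continuous.
exact/eps_cvgP/cvA.
Qed.

Lemma sum_geometric (K : fieldType) (x : K) (n : nat) :
  1 - x != 0 -> \sum_(k < n) x ^+ k = (1 - x ^+ n) / (1 - x).
Proof.
move=> x1; have := subrX1 x n; rewrite -opprB -[x - 1]opprB mulNr => /oppr_inj ->.
by rewrite mulrC mulKf.
Qed.

Lemma eps_cvg_geometric2 (K : numFieldType) (a b x y : K) :
  1 - x != 0 -> 1 - y != 0 ->
  eps_cvg (fun m => x ^+ m) 0 -> eps_cvg (fun m => y ^+ m) 0 ->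
  eps_cvg (fun n => \sum_(k < n) (a * x ^+ k + b * y ^+ k))
          (a / (1 - x) + b / (1 - y)).
Proof.
move=> x1 y1 /eps_cvgP cx /eps_cvgP cy; apply/eps_cvgP.
under eq_fun do rewrite big_split -!mulr_sumr /= !sum_geometric //.
have -> : a / (1 - x) + b / (1 - y) = a * ((1 - 0) / (1 - x)) + b * ((1 - 0) / (1 - y)).
  by rewrite subr0 !mul1r.
by apply: cvgD; apply: cvgM; [exact: cvg_cst| |exact: cvg_cst|];
  apply: cvgM; [|exact: cvg_cst| |exact: cvg_cst]; apply: cvgB => //; exact: cvg_cst.
Qed.

Lemma ler_sum_geometric (K : numFieldType) (r : K) (n : nat) :
  0 <= r < 1 -> \sum_(k < n) r ^+ k <= (1 - r)^-1.
Proof.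
case/andP=> r0 r1; rewrite sum_geometric; last by rewrite gt_eqF // subr_gt0.
by rewrite ler_piMl ?invr_ge0 ?subr_ge0 ?(ltW r1) // gerBl exprn_ge0.
Qed.

Lemma eps_cvg_expr (R : realType) (x : R[i]) :
  `|x| < 1 -> eps_cvg (fun n => x ^+ n) 0.
Proof.
move=> x1 eps eps_gt0.
(* Both the norm of [x] and [eps] are real, so the claim is carried to [R], where [cvg_expr]
   applies. *)
have xE : `|x| = (complex.Re `|x|)%:C by rewrite RRe_real ?normr_real.
have eE : eps = (complex.Re eps)%:C by rewrite RRe_real // realE ltW.
have e0 : 0 < complex.Re eps by rewrite -ltcR -eE.
have x0 : 0 <= complex.Re `|x| by rewrite -lecR -xE; exact: normr_ge0.
have : `|complex.Re `|x| | < 1 by rewrite ger0_norm // -ltcR -xE.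
move=> /cvg_expr/cvgrPdist_lt/(_ _ e0)[M0 _ lt_eps].
exists M0 => M /lt_eps; rewrite /= sub0r normrN ger0_norm ?exprn_ge0 // => lt_M.
by rewrite subr0 normrX xE eE -rmorphXn /= ltcR.
Qed.

(** Bounding both minors by their Leibniz sums and enlarging [P] to all maps only adds nonnegative
    terms; a sum over all maps of a product over [i] is then a product of sums over [k]. *)
Lemma sum_norm_det_le (K : numDomainType) (N n : nat)
    (P : pred {ffun 'I_N -> 'I_n}) (A : 'M[K]_(N, n)) (B : 'M[K]_(n, N)) :
  \sum_(f : {ffun 'I_N -> 'I_n} | P f) `|\det (colsub f A)| * `|\det (rowsub f B)|
  <= \sum_(s : 'S_N) \sum_(t : 'S_N) \prod_i \sum_k `|A (s i) k| * `|B k (t i)|.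
Proof.
have norm_det (M : 'M[K]_N) : `|\det M| <= \sum_(s : 'S_N) \prod_i `|M i (s i)|.
  apply: (le_trans (ler_norm_sum _ _ _)); apply: ler_sum => s _.
  by rewrite normrM normr_sign mul1r normr_prod.
apply: (@le_trans _ _ (\sum_(f : {ffun 'I_N -> 'I_n})
    `|\det (colsub f A)| * `|\det (rowsub f B)|)).
  by rewrite big_mkcond; apply: ler_sum => f _; case: (P f) => //; rewrite mulr_ge0.
apply: (@le_trans _ _ (\sum_(f : {ffun 'I_N -> 'I_n}) \sum_(s : 'S_N) \sum_(t : 'S_N)
    \prod_i (`|A (s i) (f i)| * `|B (f i) (t i)|))).
  apply: ler_sum => f _.
  (* Transposing the minor of [A] makes both Leibniz products run over the same [f i]. *)
  rewrite -det_tr; apply: (le_trans (ler_pM _ _ (norm_det _) (norm_det _))) => //.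
  rewrite mulr_suml; apply: ler_sum => s _; rewrite mulr_sumr; apply: ler_sum => t _.
  by rewrite -big_split /=; apply: ler_prod => i _; rewrite !mxE lexx mulr_ge0.
rewrite exchange_big /=; apply: ler_sum => s _.
rewrite exchange_big /=; apply: ler_sum => t _.
by rewrite bigA_distr_bigA.
Qed.

(** * The Cauchy identity *)

Section Cauchy.
Variables (R : realType) (q g s0 xi0 : R[i]).

Definition alphac (u : R[i]) : R[i] :=
  1 + g ^+ 2 * s0 ^+ 2 - s0 * g * (u * xi0)^-1 - s0 * g * u * xi0.
Definition betac (u : R[i]) : R[i] :=
  - g * q - s0 ^+ 2 * g + s0 * g * (u * xi0)^-1 + s0 * g * q * u * xi0.

Lemma cfun_geometric (u v : R[i]) (k : nat) :
  cfun q g s0 xi0 k u * v ^+ k =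
  alphac u * (u * v) ^+ k + betac u * (q * u * v) ^+ k.
Proof.
rewrite /cfun /alphac /betac !exprMn; set w := (u * xi0)^-1.
by rewrite exprS; ring.
Qed.

Lemma zfun_partial_fractions (u v : R[i]) :
  u != 0 -> xi0 != 0 -> 1 - u * v != 0 -> 1 - q * u * v != 0 ->
  zfun q g s0 xi0 u v = alphac u / (1 - u * v) + betac u / (1 - q * u * v).
Proof.
move=> u0 x0 uv quv; rewrite /zfun /alphac /betac.
by field; rewrite u0 x0 uv quv.
Qed.

Lemma norm_lt1_subr_neq0 (x : R[i]) : `|x| < 1 -> 1 - x != 0.
Proof.
by move=> x1; rewrite subr_eq0; apply: contraTneq x1 => <-; rewrite normr1 ltxx.
Qed.

Lemma eps_cvg_zfun (u v : R[i]) :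
  u != 0 -> xi0 != 0 -> `|u * v| < 1 -> `|q * u * v| < 1 ->
  eps_cvg (fun n => \sum_(k < n) cfun q g s0 xi0 k u * v ^+ k)
          (zfun q g s0 xi0 u v).
Proof.
move=> u0 x0 uv quv; rewrite zfun_partial_fractions ?norm_lt1_subr_neq0 //.
under eq_fun do under eq_bigr do rewrite cfun_geometric.
by apply: eps_cvg_geometric2; rewrite ?norm_lt1_subr_neq0 //; apply: eps_cvg_expr.
Qed.

Lemma sum_norm_cfun_le (u v : R[i]) (n : nat) :
  `|u * v| < 1 -> `|q * u * v| < 1 ->
  \sum_(k < n) `|cfun q g s0 xi0 k u| * `|v ^+ k| <=
  `|alphac u| / (1 - `|u * v|) + `|betac u| / (1 - `|q * u * v|).
Proof.
move=> uv quv.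
apply: (@le_trans _ _ (`|alphac u| * \sum_(k < n) `|u * v| ^+ k +
                      `|betac u| * \sum_(k < n) `|q * u * v| ^+ k)).
  rewrite !mulr_sumr -big_split /=; apply: ler_sum => k _.
  by rewrite -normrM cfun_geometric -!normrX -!normrM ler_normD.
by apply: lerD; rewrite ler_wpM2l // ler_sum_geometric // normr_ge0.
Qed.

Section Truncation.
Variables (N : nat) (u v : 'I_N.+1 -> R[i]).

Definition cmx (n : nat) : 'M[R[i]]_(N.+1, n) :=
  \matrix_(i, k) cfun q g s0 xi0 k (u i).
Definition vmx (n : nat) : 'M[R[i]]_(n, N.+1) := \matrix_(k, j) v j ^+ k.

(** The combination [h] is left free so that the lemma serves both the series and the series of its
    absolute values. *)
Lemma sum_signb_minors (T : nmodType) (h : R[i] -> R[i] -> T) (M : nat) :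
  \sum_(lam : {ffun 'I_N.+1 -> 'I_M} | signb lam)
     h (Clam q g s0 xi0 (lamnat lam) u) (schur (lamnat lam) v) =
  \sum_(f : {ffun 'I_N.+1 -> 'I_(M + N)} | strict_decr f)
     h (\det (colsub f (cmx (M + N))) / vdm u)
       (\det (rowsub f (vmx (M + N))) / vdm v).
Proof.
pose G (mu : 'I_N.+1 -> nat) :=
  h (\det (\matrix_(i < N.+1, j < N.+1) cfun q g s0 xi0 (mu i) (u j)) / vdm u)
    (\det (\matrix_(i < N.+1, j < N.+1) v i ^+ mu j) / vdm v).
rewrite -[LHS](@sum_strict_decr_signb _ N M G).
  apply: eq_bigr => f _; rewrite /G -[in RHS]det_tr -[\det (rowsub _ _)]det_tr.
  by congr (h (_ / _) (_ / _)); congr (\det _); apply/matrixP => i j; rewrite !mxE.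
move=> f1 f2 eqf; rewrite /G.
by congr (h (_ / _) (_ / _)); congr (\det _); apply/matrixP => i j; rewrite !mxE eqf.
Qed.

Lemma partial_sum_det (M : nat) :
  partial_sum M (fun lam : 'I_N.+1 -> nat => Clam q g s0 xi0 lam u * schur lam v) =
  \det (\matrix_(i, j) \sum_(k < M + N) cfun q g s0 xi0 k (u i) * v j ^+ k)
    / (vdm u * vdm v).
Proof.
rewrite /partial_sum (sum_signb_minors (fun a b => a * b)).
rewrite (eq_bigr (fun f : {ffun 'I_N.+1 -> 'I_(M + N)} =>
  \det (colsub f (cmx (M + N))) * \det (rowsub f (vmx (M + N))) / (vdm u * vdm v))); last first.
  by move=> f _; rewrite mulf_div.
rewrite -mulr_suml -Cauchy_Binet; congr (\det _ / _).
by apply/matrixP => i j; rewrite !mxE; apply: eq_bigr => k _; rewrite !mxE.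
Qed.

Lemma partial_sum_norm_le (M : nat) :
  (forall i j, `|u i * v j| < 1) -> (forall i j, `|q * u i * v j| < 1) ->
  partial_sum M (fun lam : 'I_N.+1 -> nat => `|Clam q g s0 xi0 lam u * schur lam v|)
  <= (\sum_(s : 'S_N.+1) \sum_(t : 'S_N.+1) \prod_i
        (`|alphac (u (s i))| / (1 - `|u (s i) * v (t i)|)
         + `|betac (u (s i))| / (1 - `|q * u (s i) * v (t i)|)))
     / `|vdm u * vdm v|.
Proof.
move=> uv quv; rewrite /partial_sum (sum_signb_minors (fun a b => `|a * b|)).
rewrite (eq_bigr (fun f : {ffun 'I_N.+1 -> 'I_(M + N)} =>
  `|\det (colsub f (cmx (M + N)))| * `|\det (rowsub f (vmx (M + N)))| / `|vdm u * vdm v|)); last first.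
  by move=> f _; rewrite mulf_div normf_div normrM.
rewrite -mulr_suml ler_wpM2r ?invr_ge0 //.
apply: (le_trans (sum_norm_det_le _ _ _)); apply: ler_sum => s _; apply: ler_sum => t _.
apply: ler_prod => i _; rewrite sumr_ge0 /=; last by move=> k _; rewrite mulr_ge0.
under eq_bigr do rewrite !mxE.
exact: sum_norm_cfun_le.
Qed.

End Truncation.

Lemma Clam_hcomp (N : nat) (u : 'I_N -> R[i]) (lam : 'I_N -> nat) :
  (forall i, u i != 0) -> (forall i j, i != j -> u i != u j) ->
  Clam q g s0 xi0 lam u =
  \det (\matrix_(i < N, j < N)
      (- g * s0 * xi0^-1 * (1 - q ^+ shifted lam j)
           * hcomp ((lam j)%:Z + i%:Z - j%:Z - 1) u
       + (1 + g ^+ 2 * s0 ^+ 2 - g * (q + s0 ^+ 2) * q ^+ shifted lam j)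
           * hcomp ((lam j)%:Z + i%:Z - j%:Z) u
       - g * s0 * xi0 * (1 - q ^+ (shifted lam j).+1)
           * hcomp ((lam j)%:Z + i%:Z - j%:Z + 1) u)).
Proof.
move=> u0 inj_u; set H := \matrix_(i, j) _.
rewrite /Clam (det_codual_expansion (u := u) (M := H)) ?mulfK ?vdm_neq0 // => i j.
by rewrite cfun_hcomp //; apply: eq_bigr => l _; rewrite mxE.
Qed.

Lemma Clam_s0_eq0 (N : nat) (u : 'I_N -> R[i]) (lam : 'I_N -> nat) : s0 = 0 ->
  Clam q g s0 xi0 lam u =
  (\prod_(j < N) (1 - g * q * q ^+ shifted lam j)) * schur lam u.
Proof.
move=> s00; rewrite /Clam /schur mulrA; congr (_ / _).
rewrite -[X in _ * X]det_tr -[X in X * _](@eq_bigr _ _ _ _ _ _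
  (fun i => (\row_(j < N) (1 - g * q * q ^+ shifted lam j)) 0 i));
  last by move=> i _; rewrite mxE.
(* At [s0 = 0], [cfun] at [k] is [u ^+ k] times a scalar depending only on [k], so each row is
   scaled, by a diagonal matrix. *)
rewrite -det_diag -det_mulmx; congr (\det _); apply/matrixP => i j.
by rewrite mul_diag_mx !mxE /cfun s00 exprS; ring.
Qed.

End Cauchy.

Theorem mainTheorem10 (R : realType) (N : nat) (q g s0 xi0 : R[i])
    (u v : 'I_N -> R[i]) :
  (1 <= N)%N ->
  xi0 != 0 ->
  (forall i, u i != 0) ->
  (forall i j, i != j -> u i != u j) ->
  (forall i j, i != j -> v i != v j) ->
  (forall i j, `|u i * v j| < 1) ->
  (forall i j, `|q * u i * v j| < 1) ->
  let F := fun lam : 'I_N -> nat => Clam q g s0 xi0 lam u * schur lam v in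
  let LHS := \det (\matrix_(i < N, j < N) zfun q g s0 xi0 (u i) (v j))
             / (vdm u * vdm v) in
  [/\ (* absolute summability over Sign_N *)
      (exists B : R[i], forall M, partial_sum M (fun lam => `|F lam|) <= B),
      (* the series over Sign_N (exhausted by lambda_1 < M) converges to LHS *)
      (forall eps : R[i], 0 < eps -> exists M0, forall M, (M0 <= M)%N ->
          `|partial_sum M F - LHS| < eps),
      (* the equivalent determinant formula in terms of h_k(u) *)
      (forall lam : 'I_N -> nat, is_sign lam ->
         Clam q g s0 xi0 lam u =
         \det (\matrix_(i < N, j < N)
            (- g * s0 * xi0^-1 * (1 - q ^+ shifted lam j)
                 * hcomp ((lam j)%:Z + i%:Z - j%:Z - 1) u
             + (1 + g ^+ 2 * s0 ^+ 2 - g * (q + s0 ^+ 2) * q ^+ shifted lam j)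
                 * hcomp ((lam j)%:Z + i%:Z - j%:Z) u
             - g * s0 * xi0 * (1 - q ^+ (shifted lam j).+1)
                 * hcomp ((lam j)%:Z + i%:Z - j%:Z + 1) u))) &
      (* the special case s0 = 0 *)
      (s0 = 0 -> forall lam : 'I_N -> nat, is_sign lam ->
         Clam q g s0 xi0 lam u =
         (\prod_(j < N) (1 - g * q * q ^+ shifted lam j)) * schur lam u)].
Proof.
case: N u v => // N u v _ xi00 u0 inj_u inj_v uv quv F LHS; split.
- by eexists => M; apply: partial_sum_norm_le.
- move=> eps eps_gt0.
  (* The determinants are compared with tolerance [eps] times this norm, which the division by the
     Vandermonde products turns back into [eps]. *)
  have W0 : 0 < `|vdm u * vdm v| by rewrite normr_gt0 mulf_neq0 ?vdm_neq0.
  pose Z n := \matrix_(i, j) \sum_(k < n) cfun q g s0 xi0 k (u i) * v j ^+ k.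
  have /eps_cvg_det/(_ (eps * `|vdm u * vdm v|))[|M0 lt_eps] :
      forall i j, eps_cvg (fun n => Z n i j)
                    ((\matrix_(i, j) zfun q g s0 xi0 (u i) (v j)) i j).
  + move=> i j; rewrite mxE; under eq_fun do rewrite mxE.
    exact: eps_cvg_zfun.
  + exact: mulr_gt0.
  (* The partial sum at [M] is the determinant truncated at [M + N], which is at least [M], so the
     same threshold works. *)
  exists M0 => M le_M; rewrite /F partial_sum_det /LHS -mulrBl normf_div.
  by rewrite ltr_pdivrMr // lt_eps // (leq_trans le_M) ?leq_addr.
- by move=> lam _; apply: Clam_hcomp.
- by move=> s00 lam _; apply: Clam_s0_eq0.
Qed.
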